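(* Let $k\geq 4$ and $\tau\in S_k$, and assume either (a) $\tau_1=k$ and $\tau_2\neq k-1$, or (b) $|\tau_i-\tau_{i+1}|>1$ for every $i\in[k-1]$. Then $$\liminf_{n\to\infty}\frac{\mathbb{E}^\tau_n(\mathrm{LAS}_n)}{n}\geq\frac{2}{L(\tau)^2}.$$
   Context: $S_n(\tau)$ is the set of permutations of $[n]$ avoiding $\tau$; $L(\tau)=\lim_{n\to\infty}|S_n(\tau)|^{1/n}$. $\mathrm{LAS}_n(\sigma)$ is the length of the longest alternating subsequence of $\sigma$, i.e. the largest $m$ with indices $i_1<\dots<i_m$ and $\sigma_{i_1}>\sigma_{i_2}<\sigma_{i_3}>\sigma_{i_4}\cdots$. $\mathbb{E}^\tau_n$ is expectation under the uniform measure on $S_n(\tau)$. *)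

(* Defs.v *)
From HB Require Import structures.
From mathcomp Require Import all_boot all_order all_algebra all_fingroup.
From mathcomp Require Import all_classical all_reals all_analysis.
Set Implicit Arguments.
Unset Strict Implicit.
Unset Printing Implicit Defensive.
Import Order.TTheory GRing.Theory Num.Theory.
Import numFieldNormedType.Exports.

(* Permutations of [n] are elements of 'S_n: positions and values are shifted
   from 1..n to 0..n-1, so one-line entry sigma_i is (s (i-1)) + 1. *)

Section Permutations.
Local Open Scope nat_scope.

Definition increasing (m n : nat) (t : {ffun 'I_m -> 'I_n}) : bool :=
  [forall i : 'I_m, forall j : 'I_m, (i < j) ==> (t i < t j)].

Definition contains (n k : nat) (s : 'S_n) (tau : 'S_k) : bool :=
  [exists t : {ffun 'I_k -> 'I_n},
     increasing t &&
     [forall i : 'I_k, forall j : 'I_k,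
        (s (t i) < s (t j)) == (tau i < tau j)]].

Definition avoiders (n k : nat) (tau : 'S_k) : {set 'S_n} :=
  [set s : 'S_n | ~~ contains s tau].

(* Descent first: even (0-based) steps go down, odd steps go up. *)
Definition alternating_along (m n : nat) (s : 'S_n) (t : {ffun 'I_m -> 'I_n}) : bool :=
  [forall i : 'I_m, forall j : 'I_m,
     (j == i.+1 :> nat) ==>
     (if odd i then s (t i) < s (t j) else s (t j) < s (t i))].

(* An increasing t : 'I_m -> 'I_n forces m <= n, so the bound on m is harmless. *)
Definition LAS (n : nat) (s : 'S_n) : nat :=
  \max_(m < n.+1 |
        [exists t : {ffun 'I_m -> 'I_n}, increasing t && alternating_along s t]) m.

Definition starts_k_not_k1 (k : nat) (tau : 'S_k) : Prop :=
  (forall i : 'I_k, i = 0 :> nat -> tau i = k - 1 :> nat) /\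
  (forall i : 'I_k, i = 1 :> nat -> tau i <> k - 2 :> nat).

Definition no_close_neighbours (k : nat) (tau : 'S_k) : Prop :=
  forall i j : 'I_k, j = i.+1 :> nat ->
    (1 < `|(tau i)%:Z - (tau j)%:Z|)%R.

End Permutations.

Section Asymptotics.
Local Open Scope ring_scope.

Definition expect_avoid (R : realType) (n k : nat) (tau : 'S_k)
    (X : 'S_n -> R) : R :=
  (\sum_(s in avoiders n tau) X s) / #|avoiders n tau|%:R.

(* The limit exists in R for every pattern with k >= 1 (Marcus-Tardos). *)
Definition growth_rate (R : realType) (k : nat) (tau : 'S_k) : R :=
  limn (fun n : nat => #|avoiders n tau|%:R `^ n%:R^-1 : R).

End Asymptotics.

(* Main.v *)
(** Writing a_n = |S_n(tau)|, let an insertion after position i of an avoider s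
    put there the two values w + 2, w + 1, where w is the value at i (case (b))
    or the largest value among positions 0..i (case (a)). This creates a peak,
    is injective, and under the hypotheses on tau preserves avoidance. If X
    counts the places of a permutation that look like such an insertion, then
    the sum of X over S_(n+2)(tau) is n a_n, and LAS >= 2 X because between two
    consecutive peaks one finds a valley. So E(LAS) >= 2 n a_n / a_(n+2), and it
    remains to bound r_n = a_n / a_(n+2) from below by 1/L^2 asymptotically.
    An insertion raises X by at most 5, so the sum of X^2 over S_(n+2)(tau) is
    at most n (n-2) a_(n-2) + 5 n a_n, and Cauchy-Schwarz gives
    r_n <= r_(n-2) + 5/n, as in Kesten's ratio limit theorem. Hence a
    value of r_n well below 1/L^2 would persist over a window of length
    proportional to n, contradicting a_n^(1/n) -> L. *)
Require Import Defs.
From HB Require Import structures.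
From mathcomp Require Import all_boot all_order all_algebra all_fingroup.
From mathcomp Require Import all_classical all_reals all_analysis.
From mathcomp Require Import zify ring lra.
Set Implicit Arguments.
Unset Strict Implicit.
Unset Printing Implicit Defensive.
Import Order.TTheory GRing.Theory Num.Theory.
Import numFieldNormedType.Exports.
Local Open Scope nat_scope.

(** * Inserting a peak *)

(** Embeds the old positions around the two new ones: the outer [lift] skips [i + 1], the inner one
    skips what then becomes [i + 2]. *)
Definition widen_at n (i q : 'I_n) : 'I_n.+2 :=
  lift (lift ord0 (lift ord_max i)) (lift (lift ord0 i) q).

(** The outer [lift_perm] puts [s p + 2] at [i + 1], the inner one [s p + 1] at [i + 2]. The value
    anchor [p] is kept apart from the place [i] because case (a) takes a prefix maximum. *)
Definition insert_peak n (s : 'S_n) (i p : 'I_n) : 'S_n.+2 :=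
  lift_perm (lift ord0 (lift ord_max i)) (lift ord0 (lift ord0 (s p)))
    (lift_perm (lift ord0 i) (lift ord0 (s p)) s).

Lemma widen_atE n (i q : 'I_n) :
  widen_at i q = (if q <= i then q : nat else q.+2) :> nat.
Proof.
rewrite /widen_at /= /bump /=; have := ltn_ord i.
case: (leqP q i); lia.
Qed.

Lemma widen_at_inj n (i : 'I_n) : injective (widen_at i).
Proof. by move=> q r /lift_inj /lift_inj. Qed.

Lemma widen_at_cases n (i : 'I_n) (q : 'I_n.+2) :
  [\/ q = i.+1 :> nat, q = i.+2 :> nat | exists r, q = widen_at i r].
Proof.
case: (unliftP (lift ord0 (lift ord_max i)) q) => [q' -> | ->]; last first.
  by apply: Or31; rewrite /= /bump /=; have := ltn_ord i; lia.
case: (unliftP (lift ord0 i) q') => [r -> | ->]; first by apply: Or33; exists r.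
by apply: Or32; rewrite /= /bump /=; have := ltn_ord i; lia.
Qed.

Lemma insert_peak_old n (s : 'S_n) (i p q : 'I_n) :
  insert_peak s i p (widen_at i q) =
  (if s q <= s p then s q : nat else (s q).+2) :> nat.
Proof.
rewrite /insert_peak /widen_at lift_perm_lift lift_perm_lift /= /bump /=.
by case: (leqP (s q) (s p)); lia.
Qed.

Lemma insert_peak_top n (s : 'S_n) (i p : 'I_n) (x : 'I_n.+2) :
  x = i.+1 :> nat -> insert_peak s i p x = (s p).+2 :> nat.
Proof.
move=> xi; rewrite /insert_peak.
have -> : x = lift ord0 (lift ord_max i).
  by apply: val_inj; rewrite /= xi /bump /=; have := ltn_ord i; lia.
by rewrite lift_perm_id.
Qed.

Lemma insert_peak_next n (s : 'S_n) (i p : 'I_n) (x : 'I_n.+2) :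
  x = i.+2 :> nat -> insert_peak s i p x = (s p).+1 :> nat.
Proof.
move=> xi; rewrite /insert_peak.
have -> : x = lift (lift ord0 (lift ord_max i)) (lift ord0 i).
  by apply: val_inj; rewrite /= xi /bump /=; have := ltn_ord i; lia.
by rewrite lift_perm_lift lift_perm_id /= /bump /=; lia.
Qed.

(** The entry at [i + 1] reveals [s p], hence how the old values were shifted; the anchors
    themselves need not be known. *)
Lemma insert_peak_inj n (s s' : 'S_n) (i p p' : 'I_n) :
  insert_peak s i p = insert_peak s' i p' -> s = s'.
Proof.
move=> e; have ep : s p = s' p' :> nat.
  have hi : lift ord0 (lift ord_max i) = i.+1 :> nat.
    by rewrite /= /bump /=; have := ltn_ord i; lia.
  move: (insert_peak_top s p hi).
  by rewrite e (insert_peak_top s' p' hi) => -[].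
apply/permP => q; apply: val_inj.
have := insert_peak_old s i p q; have := insert_peak_old s' i p' q.
rewrite e => -> /=; rewrite ep.
by case: (leqP (s q) (s' p')); case: (leqP (s' q) (s' p')); lia.
Qed.

(** A left inverse of [widen_at]; the default [p] is the image of both new positions. *)
Definition collapse n (i p : 'I_n) (q : 'I_n.+2) : 'I_n :=
  odflt p [pick r | widen_at i r == q].

Lemma collapse_widen n (i p r : 'I_n) : collapse i p (widen_at i r) = r.
Proof.
rewrite /collapse; case: pickP => [r' /eqP /widen_at_inj // | /(_ r)].
by rewrite eqxx.
Qed.

Lemma collapse_new n (i p : 'I_n) (q : 'I_n.+2) :
  i < q <= i.+2 -> collapse i p q = p.
Proof.
move=> hq; rewrite /collapse; case: pickP => [r' /eqP e | //].
by move: hq; rewrite -e widen_atE; case: (leqP r' i); lia.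
Qed.

Lemma collapse_leq n (i p : 'I_n) (q : 'I_n.+2) :
  q <= i -> collapse i p q = q :> nat.
Proof.
case: (widen_at_cases i q) => [|| [r ->]]; try lia.
by rewrite collapse_widen widen_atE; case: (leqP r i); lia.
Qed.

Lemma collapse_gtn n (i p : 'I_n) (q : 'I_n.+2) :
  i.+2 < q -> collapse i p q = q - 2 :> nat.
Proof.
case: (widen_at_cases i q) => [|| [r ->]]; try lia.
by rewrite collapse_widen widen_atE; case: (leqP r i); lia.
Qed.

(* The values s p, s p + 1, s p + 2 sit at p and at the two new positions, so
   all three play the role of p as far as comparisons with others go. *)
Lemma collapse_mono n (s : 'S_n) (i p : 'I_n) (q r : 'I_n.+2) :
  collapse i p q != collapse i p r ->
  (s (collapse i p q) < s (collapse i p r)) =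
  (insert_peak s i p q < insert_peak s i p r).
Proof.
have sinj (a b : 'I_n) : a != b -> s a <> s b :> nat.
  by move=> /eqP ab /val_inj /perm_inj.
case: (widen_at_cases i q) => [qi|qi|[q' ->]];
  case: (widen_at_cases i r) => [ri|ri|[r' ->]];
  rewrite ?collapse_widen ?insert_peak_old
    ?(insert_peak_top s p qi) ?(insert_peak_top s p ri)
    ?(insert_peak_next s p qi) ?(insert_peak_next s p ri)
    ?(@collapse_new _ i p q) ?(@collapse_new _ i p r) ?eqxx //; try lia;
  move=> /sinj.
- by case: (leqP (s r') (s p)); lia.
- by case: (leqP (s r') (s p)); lia.
- by case: (leqP (s q') (s p)); lia.
- by case: (leqP (s q') (s p)); lia.
- by case: (leqP (s q') (s p)); case: (leqP (s r') (s p)); lia.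
Qed.

(** * Pattern containment before and after an insertion *)

Lemma containsP n k (s : 'S_n) (tau : 'S_k) :
  reflect (exists t : 'I_k -> 'I_n,
    (forall i j : 'I_k, i < j -> t i < t j) /\
    (forall i j : 'I_k, (s (t i) < s (t j)) = (tau i < tau j)))
  (contains s tau).
Proof.
apply: (iffP existsP) => [[t /andP[/forallP inc /forallP occ]] | [t [inc occ]]].
  exists t; split=> i j; first by move: (inc i) => /forallP/(_ j)/implyP.
  by move: (occ i) => /forallP/(_ j)/eqP.
exists (finfun t); apply/andP; split; apply/forallP => i; apply/forallP => j.
  by apply/implyP; rewrite !ffunE; apply: inc.
by rewrite !ffunE occ.
Qed.

Lemma contains_small n k (s : 'S_n) (tau : 'S_k) : n < k -> ~~ contains s tau.
Proof.
move=> nk; apply/containsP => -[t [inc _]].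
have tinj : injective t.
  move=> i j tij; apply: val_inj; move: (inc i j) (inc j i); rewrite tij ltnn.
  by case: (ltngtP i j) => // _ => [/(_ isT) | _ /(_ isT)].
by have := leq_card t tinj; rewrite !card_ord leqNgt nk.
Qed.

Lemma contains_insert n k (s : 'S_n) (tau : 'S_k) (i p : 'I_n) :
  contains s tau -> contains (insert_peak s i p) tau.
Proof.
move=> /containsP[t [inc occ]]; apply/containsP; exists (widen_at i \o t).
split=> [a b /inc ab | a b]; rewrite /comp.
  by rewrite !widen_atE; case: (leqP (t a) i); case: (leqP (t b) i); lia.
rewrite -occ; have [-> | tab] := eqVneq (t a) (t b); first by rewrite !ltnn.
by rewrite -collapse_mono !collapse_widen.
Qed.

(** Common end of both cases: once collapsing keeps the positions of an occurrence distinct and in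
    order, [collapse_mono] transfers the comparisons of values. *)
Lemma contains_collapse n k (s : 'S_n) (tau : 'S_k) (i p : 'I_n)
    (t : 'I_k -> 'I_n.+2) :
  (forall a b : 'I_k, (insert_peak s i p (t a) < insert_peak s i p (t b)) =
     (tau a < tau b)) ->
  (forall a b : 'I_k, a < b -> collapse i p (t a) < collapse i p (t b)) ->
  contains s tau.
Proof.
move=> occ inc; apply/containsP; exists (collapse i p \o t); split=> // a b /=.
have [-> | ab] := eqVneq a b; first by rewrite !ltnn.
rewrite collapse_mono ?occ //; apply/eqP => /(congr1 val) /= e.
have := inc a b; have := inc b a; rewrite e ltnn.
have : a <> b :> nat by move=> /val_inj eab; rewrite eab eqxx in ab.
by case: (ltngtP a b) => // _ _ => [_ /(_ isT) | /(_ isT)].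
Qed.

(** The value [tau a + 1] is attained. A gap in values thus yields a third entry that an occurrence
    must also realise. *)
Lemma perm_between k (tau : 'S_k) (a b : 'I_k) :
  (tau a).+1 < tau b -> exists c : 'I_k, tau a < tau c < tau b.
Proof.
move=> ab; have lt : (tau a).+1 < k by apply: ltn_trans ab _.
exists ((tau^-1)%g (Ordinal lt)); rewrite permKV /=; lia.
Qed.

(* A consecutive block of values inserted at consecutive positions could only
   be hit twice by an occurrence of tau through neighbours with close values. *)
Lemma no_close_insert n k (s : 'S_n) (tau : 'S_k) (i : 'I_n) :
  no_close_neighbours tau ->
  contains (insert_peak s i i) tau -> contains s tau.
Proof.
move=> far /containsP[t [inc occ]].
set s' := insert_peak s i i in occ.
have sep (a b : 'I_k) : b = a.+1 :> nat ->
    exists c : 'I_k, tau a < tau c < tau b \/ tau b < tau c < tau a.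
  move=> ab; have : (tau a).+1 < tau b \/ (tau b).+1 < tau a.
    by have := far a b ab; lia.
  by case=> /perm_between[c hc]; exists c; [left | right].
have s0 (q : 'I_n.+2) : q = i :> nat -> s' q = s i :> nat.
  move=> qi; have -> : q = widen_at i i.
    by apply: ord_inj; rewrite widen_atE leqnn.
  by rewrite insert_peak_old leqnn.
have s1 (q : 'I_n.+2) : q = i.+1 :> nat -> s' q = (s i).+2 :> nat.
  exact: insert_peak_top.
have s2 (q : 'I_n.+2) : q = i.+2 :> nat -> s' q = (s i).+1 :> nat.
  exact: insert_peak_next.
(* Positions [i + 1] and [i + 2] carry consecutive values, leaving no room for the intermediate
   entry given by [sep]. *)
have no12 (a b : 'I_k) : t a = i.+1 :> nat -> t b = i.+2 :> nat ->
    b = a.+1 :> nat -> False.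
  move=> /s1 ta /s2 tb /sep[c]; rewrite -!occ ta tb; lia.
(* At most one entry of the occurrence lies in the block [i..i + 2]. Replacing [b] by the successor
   [b1] of [a] reduces this to neighbours in [tau]. *)
have ninj (a b : 'I_k) : a < b -> i <= t a -> t b <= i.+2 -> False.
  move=> ab ia ib; have a1k : a.+1 < k by have := ltn_ord b; lia.
  pose b1 := Ordinal a1k.
  have tab1 : t a < t b1 by apply: inc.
  have tb1 : t b1 <= i.+2.
    have [e | ne] := eqVneq b1 b; first by rewrite e.
    suff /inc : b1 < b by lia.
    move: ab; rewrite leq_eqVlt => /orP[/eqP e|//].
    by case/eqP: ne; exact: val_inj.
  have cases : [\/ t a = i.+1 :> nat /\ t b1 = i.+2 :> nat,
     t a = i :> nat /\ t b1 = i.+1 :> nat |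
     t a = i :> nat /\ t b1 = i.+2 :> nat].
    have [e1|e1] : t a = i :> nat \/ t a = i.+1 :> nat by lia.
      have [e2|e2] : t b1 = i.+1 :> nat \/ t b1 = i.+2 :> nat by lia.
        exact: Or32.
      exact: Or33.
    by apply: Or31; lia.
  case: cases => -[ta tb].
  - by apply: no12 ta tb _.
  (* The only value between those at [i] and [i + 1] sits at [i + 2], so the successor of [b1] lands
     there and [no12] applies. *)
  - have [c] := sep a b1 erefl; rewrite -!occ (s0 _ ta) (s1 _ tb) => hc.
    have sc : s' (t c) = (s i).+1 :> nat by lia.
    have tc : t c = i.+2 :> nat.
      have lt : i.+2 < n.+2 by have := ltn_ord i; lia.
      have := s2 (Ordinal lt) erefl; rewrite -sc => /val_inj/perm_inj <- //.
    have b1c : b1 < c.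
      case: (ltngtP b1 c) => // [/inc | /val_inj e]; first lia.
      by move: tb tc; rewrite e; lia.
    have c1k : b1.+1 < k by have := ltn_ord c; lia.
    pose d := Ordinal c1k.
    have td1 : t b1 < t d by apply: inc.
    have td : t d = i.+2 :> nat.
      have : t d <= t c.
        case: (ltngtP d c) => [/inc | | /val_inj -> //]; first lia.
        by move: b1c => /=; lia.
      by lia.
    exact: no12 tb td _.
  - by have [c] := sep a b1 erefl; rewrite -!occ (s0 _ ta) (s2 _ tb); lia.
apply: contains_collapse occ _ => a b ab.
have nh := ninj a b ab; have tab := inc a b ab.
have cb (q : 'I_n.+2) : i <= q <= i.+2 -> collapse i i q = i :> nat.
  rewrite leq_eqVlt => /andP[/orP[/eqP iq _ | iq q2]].
    by rewrite collapse_leq; lia.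
  by rewrite collapse_new //; lia.
have [ai|ai] := ltnP (t a) i.
  rewrite (collapse_leq i (ltnW ai)).
  have [bi|bi] := ltnP (t b) i; first by rewrite (collapse_leq i (ltnW bi)).
  have [b2|b2] := leqP (t b) i.+2; first by rewrite cb ?bi.
  by rewrite (collapse_gtn i b2); lia.
have b2 : i.+2 < t b by rewrite ltnNge; apply/negP; exact: nh.
rewrite (collapse_gtn i b2).
have [a2|a2] := leqP (t a) i.+2; first by rewrite cb ?ai //; lia.
by rewrite (collapse_gtn i a2); lia.
Qed.

(* The two new entries are left-to-right maxima up to one another, hence can
   only play the role of the leading maximum of tau, as position p could. *)
Lemma starts_k_insert n k (s : 'S_n) (tau : 'S_k) (i p : 'I_n) : 1 < k ->
  starts_k_not_k1 tau -> p <= i ->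
  (forall q : 'I_n, q <= i -> s q <= s p) ->
  contains (insert_peak s i p) tau -> contains s tau.
Proof.
move=> k1 [tau0 tau1] pi pmax /containsP[t [inc occ]].
set s' := insert_peak s i p in occ.
have s0 (q : 'I_n.+2) : q <= i -> s' q <= s p.
  move=> qi; have [|| [r e]] := widen_at_cases i q; try lia.
  move: qi; rewrite e widen_atE insert_peak_old.
  have [ri _|] := leqP r i; last by lia.
  by rewrite (pmax _ ri) (pmax _ ri).
have s1 (q : 'I_n.+2) : q = i.+1 :> nat -> s' q = (s p).+2 :> nat.
  exact: insert_peak_top.
have s2 (q : 'I_n.+2) : q = i.+2 :> nat -> s' q = (s p).+1 :> nat.
  exact: insert_peak_next.
pose o0 := Ordinal (ltnW k1); pose o1 := Ordinal k1.
have t0 : tau o0 = k - 1 :> nat by exact: tau0.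
have t1 : tau o1 <> k - 2 :> nat by exact: tau1.
have max0 (a : 'I_k) : 0 < a -> tau a < tau o0.
  move=> a0; have := ltn_ord (tau a); rewrite t0 => ak.
  have : tau a <> tau o0 :> nat.
    by move=> /val_inj/perm_inj e; rewrite e in a0.
  by rewrite t0; lia.
(* An entry other than the first needs a larger one before it. At a new position this forces
   [t o0 = i + 1] and [t a = i + 2], hence [t o1 = i + 2]; but [tau o0] and [tau o1] differ by at
   least 2, while these two values are consecutive. *)
have lead (a : 'I_k) : i < t a <= i.+2 -> a = 0 :> nat.
  move=> ta; apply/eqP; rewrite -leqn0 leqNgt; apply/negP => a0.
  have ta0 : t o0 < t a by apply: inc.
  have := max0 a a0; rewrite -occ => lt.
  have [e|e] : t a = i.+1 :> nat \/ t a = i.+2 :> nat by lia.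
    by move: lt; rewrite (s1 _ e); have := s0 (t o0); lia.
  have e0 : t o0 = i.+1 :> nat.
    have [] : t o0 <= i \/ t o0 = i.+1 :> nat by lia.
      by move=> /s0; move: lt; rewrite (s2 _ e); lia.
    by [].
  have e1 : t o1 = i.+2 :> nat.
    have : t o0 < t o1 by apply: inc.
    have [ea|ea] := eqVneq a o1; first by rewrite -ea.
    have : t o1 < t a.
      apply: inc => /=; rewrite ltn_neqAle a0 andbT; apply/eqP => e'.
      by move/eqP: ea; apply; apply: val_inj.
    lia.
  have : (tau o1).+1 < tau o0 by have := max0 o1 isT; rewrite t0; lia.
  move=> /perm_between[c]; rewrite -!occ (s1 _ e0) (s2 _ e1); lia.
apply: contains_collapse occ _ => a b ab; have tab := inc a b ab.
have nb : ~ (i < t b <= i.+2) by move=> /lead; lia.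
have [ai|ai] := leqP (t a) i.
  rewrite (collapse_leq p ai).
  have [bi|bi] := leqP (t b) i; first by rewrite (collapse_leq p bi).
  have b2 : i.+2 < t b by lia.
  by rewrite (collapse_gtn p b2); lia.
have b2 : i.+2 < t b by lia.
rewrite (collapse_gtn p b2).
have [a2|a2] := leqP (t a) i.+2; first by rewrite collapse_new ?ai //; lia.
by rewrite (collapse_gtn p a2); lia.
Qed.

(** * Counting the insertion places *)

(* [c = true] is for patterns starting with their maximum, where the anchor of
   i is the position of the maximum of s over 0..i, and [c = false] for
   patterns without close neighbours, where the anchor is i itself. *)
Definition is_anchor c n (s : 'S_n) (i p : 'I_n) : bool :=
  if c then (p <= i) && [forall q : 'I_n, (q <= i) ==> (s q <= s p)]
  else p == i.

Definition anchor c n (s : 'S_n) (i : 'I_n) : 'I_n :=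
  if c then [arg max_(q > i | q <= i) s q] else i.

Lemma is_anchor_max n (s : 'S_n) (i p : 'I_n) :
  reflect (p <= i /\ forall q : 'I_n, q <= i -> s q <= s p)
    (is_anchor true s i p).
Proof.
apply: (iffP andP) => -[pi h]; split=> //.
  by move=> q qi; move/forallP/(_ q)/implyP: h; apply.
by apply/forallP => q; apply/implyP; apply: h.
Qed.

Lemma is_anchor_leq c n (s : 'S_n) (i p : 'I_n) : is_anchor c s i p -> p <= i.
Proof. by case: c => [/is_anchor_max[]// | /eqP->]. Qed.

Lemma is_anchor_ge c n (s : 'S_n) (i p : 'I_n) :
  is_anchor c s i p -> s i <= s p.
Proof. by case: c => [/is_anchor_max[_]/(_ i (leqnn i))// | /eqP->]. Qed.

Lemma anchorP c n (s : 'S_n) (i : 'I_n) : is_anchor c s i (anchor c s i).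
Proof.
rewrite /anchor; case: c; last exact: eqxx.
by case: arg_maxnP => //= p pi pmax; apply/is_anchor_max; split.
Qed.

Lemma is_anchor_uniq c n (s : 'S_n) (i p q : 'I_n) :
  is_anchor c s i p -> is_anchor c s i q -> p = q.
Proof.
case: c => [/is_anchor_max[pi pm] /is_anchor_max[qi qm] | /eqP-> /eqP->//].
apply: (@perm_inj _ s); apply: val_inj; apply/eqP.
by rewrite eqn_leq (pm _ qi) (qm _ pi).
Qed.

(** Recognises the trace of an insertion after [i]; the witnesses [x] and [y] also force [i + 2] to
    be a valid position. *)
Definition special c n (s : 'S_n) (i : 'I_n) : bool :=
  [exists p : 'I_n, exists x : 'I_n, exists y : 'I_n,
    [&& is_anchor c s i p, x == i.+1 :> nat, y == i.+2 :> nat,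
        s x == (s p).+2 :> nat & s y == (s p).+1 :> nat]].

Lemma specialP c n (s : 'S_n) (i : 'I_n) :
  reflect (exists p x y : 'I_n,
    [/\ is_anchor c s i p, x = i.+1 :> nat, y = i.+2 :> nat,
        s x = (s p).+2 :> nat & s y = (s p).+1 :> nat])
  (special c s i).
Proof.
apply: (iffP existsP) => [[p /existsP[x /existsP[y]]] | [p [x [y]]]].
  by case/and5P => ? /eqP? /eqP? /eqP? /eqP?; exists p, x, y.
case=> ? ? ? ? ?; exists p; apply/existsP; exists x; apply/existsP; exists y.
by apply/and5P; split=> //; apply/eqP.
Qed.

Definition insert c n (s : 'S_n) (i : 'I_n) : 'S_n.+2 :=
  insert_peak s i (anchor c s i).

Lemma widen_at_id n (i : 'I_n) : widen_at i i = i :> nat.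
Proof. by rewrite widen_atE leqnn. Qed.

Lemma is_anchor_insert c n (s : 'S_n) (i p : 'I_n) :
  is_anchor c s i p ->
  is_anchor c (insert_peak s i p) (widen_at i i) (widen_at i p).
Proof.
case: c => [/is_anchor_max[pi pm] | /eqP->]; last exact: eqxx.
apply/is_anchor_max; split; first by rewrite !widen_atE leqnn pi.
move=> q; rewrite widen_at_id => qi.
have [|| [r e]] := widen_at_cases i q; try lia.
move: qi; rewrite e widen_atE !insert_peak_old leqnn.
have [ri _|] := leqP r i; last by lia.
by rewrite (pm _ ri) (pm _ ri).
Qed.

Lemma special_insert c n (s : 'S_n) (i : 'I_n) :
  special c (insert c s i) (widen_at i i).
Proof.
have x1 : i.+1 < n.+2 by have := ltn_ord i; lia.
have y1 : i.+2 < n.+2 by have := ltn_ord i; lia.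
apply/specialP; exists (widen_at i (anchor c s i)), (Ordinal x1), (Ordinal y1).
rewrite /insert widen_at_id insert_peak_old leqnn.
by rewrite insert_peak_top // insert_peak_next //; split=> //;
  apply: is_anchor_insert; exact: anchorP.
Qed.

Lemma lift_perm_delete n (s : 'S_n.+1) (i : 'I_n.+1) :
  exists s' : 'S_n, s = lift_perm i (s i) s'.
Proof.
pose f (q : 'I_n) := odflt q (unlift (s i) (s (lift i q))).
have fE q : s (lift i q) = lift (s i) (f q).
  have ne : s i != s (lift i q) by rewrite (inj_eq perm_inj) neq_lift.
  by rewrite /f; have [j -> ->] := unlift_some ne.
have finj : injective f.
  move=> q r e; apply: (@lift_inj _ i); apply: (@perm_inj _ s).
  by rewrite !fE e.
exists (perm finj); apply/permP => q.
case: (unliftP i q) => [r -> | ->]; last by rewrite lift_perm_id.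
by rewrite lift_perm_lift permE fE.
Qed.

(** Deleting the entries at [i' + 1] and [i' + 2] undoes the insertion, so every special place
    arises from one. *)
Lemma special_delete c n (s' : 'S_n.+2) (i' : 'I_n.+2) : special c s' i' ->
  exists (s : 'S_n) (i : 'I_n), i' = widen_at i i /\ s' = insert c s i.
Proof.
move=> /specialP[p' [x [y [anc xi yi sx sy]]]].
have ni : i' < n by have := ltn_ord y; lia.
pose i := Ordinal ni.
have p'i := is_anchor_leq anc.
have np : p' < n by lia.
pose p := Ordinal np.
have i'E : i' = widen_at i i by apply: ord_inj; rewrite widen_at_id.
have p'E : p' = widen_at i p by apply: ord_inj; rewrite widen_atE p'i.
have xE : x = lift ord0 (lift ord_max i).
  by apply: ord_inj; rewrite /= xi /bump /=; lia.
have yE : y = lift (lift ord0 (lift ord_max i)) (lift ord0 i).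
  by apply: ord_inj; rewrite /= yi /bump /=; lia.
have [s1 s'E] := lift_perm_delete s' x.
have [s s1E] := lift_perm_delete s1 (lift ord0 i).
have s1y : s1 (lift ord0 i) = (s' p').+1 :> nat.
  move: sy; rewrite {1}s'E yE -xE lift_perm_lift /= sx /bump.
  by case: (leqP (s' p').+2 (s1 (lift ord0 i))); lia.
have sp : s p = s' p' :> nat.
  move: sx s1y; rewrite p'E /widen_at -xE; set w := s' _.
  have : s' (lift x (lift (lift ord0 i) p)) =
      lift (s' x) (lift (s1 (lift ord0 i)) (s p)).
    by rewrite {1}s'E {1}s1E !lift_perm_lift.
  rewrite -/w => /(congr1 (@nat_of_ord _)) /= e e1 e2; move: e.
  rewrite e1 e2 /bump; case: (leqP w.+1 (s p)); case: leqP; lia.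
have s'ins : s' = insert_peak s i p.
  rewrite {1}s'E {1}s1E /insert_peak -xE.
  congr (lift_perm _ _ (lift_perm _ _ _)).
    by apply: ord_inj; rewrite sx /= /bump /= sp.
  by apply: ord_inj; rewrite s1y /= /bump /= sp.
exists s, i; split=> //; rewrite /insert.
suff -> : anchor c s i = p by [].
apply: is_anchor_uniq (anchorP c s i) _.
move: anc; rewrite {}i'E {}p'E s'ins; case: c => [|/eqP/widen_at_inj->];
  last exact: eqxx.
move=> /is_anchor_max[pi pm]; apply/is_anchor_max; split=> // q qi.
have := pm (widen_at i q); rewrite !widen_atE leqnn qi => /(_ qi).
by rewrite !insert_peak_old leqnn; case: (leqP (s q) (s p)); lia.
Qed.

(** Away from [j] the entries at [i' + 1] and [i' + 2] are old, and old values that are consecutive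
    stay so when the inserted pair is removed. Only the anchor needs care. *)
Lemma special_survives c n (s : 'S_n) (j pj : 'I_n) (i' : 'I_n.+2) :
  pj <= j -> special c (insert_peak s j pj) i' ->
  (j <= i'.+2 /\ i' <= j.+2) \/ exists2 i, special c s i & i' = widen_at j i.
Proof.
move=> pjj /specialP[p' [x' [y' [anc xi yi sx sy]]]].
have [near|far] : (j <= i'.+2 /\ i' <= j.+2) \/ (i'.+2 < j \/ j.+2 < i') by lia.
  by left.
right.
have [|| [x xE]] := widen_at_cases j x'; try lia.
have [|| [y yE]] := widen_at_cases j y'; try lia.
have [|| [i iE]] := widen_at_cases j i'; try lia.
move: (widen_atE j x) (widen_atE j y) (widen_atE j i); rewrite -xE -yE -iE.
move=> xv yv iv.
have xi1 : x = i.+1 :> nat.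
  by move: xv iv; case: (leqP x j); case: (leqP i j); lia.
have yi1 : y = i.+2 :> nat.
  by move: yv iv; case: (leqP y j); case: (leqP i j); lia.
exists i => //; apply/specialP.
move: sx sy; rewrite xE yE !insert_peak_old.
have mono (q r : 'I_n) : insert_peak s j pj (widen_at j q) <=
    insert_peak s j pj (widen_at j r) -> s q <= s r.
  rewrite !insert_peak_old.
  by case: (leqP (s q) (s pj)); case: (leqP (s r) (s pj)); lia.
have posmono (q r : 'I_n) : q <= r -> widen_at j q <= widen_at j r.
  by rewrite !widen_atE; case: (leqP q j); case: (leqP r j); lia.
(* In case (a) the anchor may lie far left of [i'], even at a new position. At [j + 1] its role
   passes to [pj]; at [j + 2] it would not be a prefix maximum. *)
have [p'j | p'j | [p pE]] := widen_at_cases j p'.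
- rewrite insert_peak_top //.
  case: c anc => [/is_anchor_max[p'i pm] | /eqP]; last first.
    by move=> e; move: p'j; rewrite e; lia.
  move=> sx sy; exists pj, x, y; split=> //.
  + apply/is_anchor_max; split=> [|q /posmono].
      by move: iv; case: (leqP i j); lia.
    rewrite -iE => /pm; rewrite insert_peak_old insert_peak_top //.
    by case: (leqP (s q) (s pj)); lia.
  + by move: sx; case: (leqP (s x) (s pj)); lia.
  + by move: sy; case: (leqP (s y) (s pj)); lia.
- case: c anc => [/is_anchor_max[p'i pm] | /eqP]; last first.
    by move=> e; move: p'j; rewrite e; lia.
  have lt : j.+1 < n.+2 by have := ltn_ord j; lia.
  have := pm (Ordinal lt); rewrite insert_peak_top // insert_peak_next //=; lia.
- rewrite pE insert_peak_old => sx sy; exists p, x, y; split=> //.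
  + case: c anc => [/is_anchor_max[p'i pm] | /eqP].
      apply/is_anchor_max; split=> [|q /posmono].
        have := widen_atE j p; rewrite -pE; move: iv.
        by case: (leqP i j); case: (leqP p j); lia.
      by rewrite -iE => /pm; rewrite pE => /mono.
    by rewrite pE iE => /widen_at_inj ->; exact: eqxx.
  + by move: sx; case: (leqP (s x) (s pj)); case: (leqP (s p) (s pj)); lia.
  + by move: sy; case: (leqP (s y) (s pj)); case: (leqP (s p) (s pj)); lia.
Qed.

Definition specials c n (s : 'S_n) : {set 'I_n} := [set i | special c s i].

Lemma card_specials_insert c n (s : 'S_n) (j : 'I_n) :
  #|specials c (insert c s j)| <= #|specials c s| + 5.
Proof.
(* The five places within distance 2 of [j]; truncated subtraction starts the range at 0 when
   [j < 2]. *)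
pose near := (fun d : 'I_5 => inord (j - 2 + d) : 'I_n.+2) @: 'I_5.
apply: (@leq_trans #|(widen_at j @: specials c s) :|: near|); last first.
  apply: (leq_trans (leq_card_setU _ _)); apply: leq_add.
    exact: leq_imset_card.
  by apply: (leq_trans (leq_imset_card _ _)); rewrite card_ord.
apply/subset_leq_card/fintype.subsetP => i'; rewrite !inE /insert.
move=> /(special_survives (is_anchor_leq (anchorP c s j)))[[ji ij]|[i si ->]].
  apply/orP; right; have lt : i' - (j - 2) < 5 by lia.
  apply/imsetP; exists (Ordinal lt) => //; apply: ord_inj.
  by rewrite inordK /=; have := ltn_ord i'; lia.
by apply/orP; left; apply: imset_f; rewrite inE.
Qed.

(** * First and second moments of the number of special places *)

Lemma sum_Cauchy_Schwarz (T : finType) (A : {set T}) (F : T -> nat) :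
  (\sum_(x in A) F x) ^ 2 <= #|A| * \sum_(x in A) F x * F x.
Proof.
rewrite -(@leq_pmul2l 2) // -mulnn big_distrlr /= big_distrr /=.
under eq_bigr do rewrite big_distrr /=.
apply: (@leq_trans (\sum_(x in A) \sum_(y in A) (F x * F x + F y * F y))).
  by apply: leq_sum => x _; apply: leq_sum => y _; rewrite !mulnn nat_Cauchy.
under eq_bigr do rewrite big_split /= sum_nat_const.
by rewrite big_split /= sum_nat_const -big_distrr /= addnn -mul2n.
Qed.

Section Counting.
Variables (c : bool) (k : nat) (tau : 'S_k).
Hypothesis insert_avoids : forall n (s : 'S_n) (i p : 'I_n),
  is_anchor c s i p -> contains (insert_peak s i p) tau -> contains s tau.

Lemma insert_in_avoiders n (s : 'S_n) (i : 'I_n) :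
  (insert c s i \in avoiders n.+2 tau) = (s \in avoiders n tau).
Proof.
rewrite !inE /insert; congr negb; apply/idP/idP; last exact: contains_insert.
exact/insert_avoids/anchorP.
Qed.

(** Insertion adds two entries, so the induction carries two consecutive sizes; size 2 is treated
    directly because the empty permutation has no insertion place. *)
Lemma avoiders_gt0 n : 2 < k -> 0 < #|avoiders n tau|.
Proof.
move=> k2; suff : 0 < #|avoiders n tau| /\ 0 < #|avoiders n.+1 tau| by case.
have small m : m < k -> 0 < #|avoiders m tau|.
  by move=> mk; apply/card_gt0P; exists 1%g; rewrite inE contains_small.
elim: n => [|n [/card_gt0P[s sA] IH]]; first by split; apply: small; lia.
split=> //; case: n s sA {IH} => [|n] s sA; first exact: small.
by apply/card_gt0P; exists (insert c s ord0); rewrite insert_in_avoiders.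
Qed.

(** Double counting: insertion is a bijection from pairs of an avoider and a place onto pairs of a
    longer avoider and a special place. Taking [F] constant gives the first moment, [F] the number
    of special places the second. *)
Lemma sum_specials n (F : 'S_n.+2 -> nat) :
  \sum_(s in avoiders n.+2 tau) #|specials c s| * F s =
  \sum_(i < n) \sum_(s in avoiders n tau) F (insert c s i).
Proof.
pose h (u : 'I_n * 'S_n) := (widen_at u.1 u.1, insert c u.2 u.1).
pose D := [set u : 'I_n * 'S_n | u.2 \in avoiders n tau].
transitivity (\sum_(u in h @: D) F u.2); last first.
  rewrite big_imset /=; last first.
    move=> [i s] [j r] _ _ hE; have := congr1 snd hE.
    have := congr1 (fun u => nat_of_ord u.1) hE; rewrite /h [LHS]widen_at_id.
    by rewrite [RHS]widen_at_id => /val_inj /= -> /insert_peak_inj /= ->.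
  rewrite pair_big_dep /=; apply: eq_bigl => -[i s] /=.
  by rewrite [in LHS]inE.
transitivity (\sum_(s in avoiders n.+2 tau) \sum_(i in specials c s) F s).
  by apply: eq_bigr => s _; rewrite sum_nat_const.
have -> : h @: D = [set u | (u.2 \in avoiders n.+2 tau) && special c u.2 u.1].
  apply/finset.setP => -[i' s']; rewrite inE /=.
  apply/imsetP/andP => [[[i s]] | [s'A /special_delete[s [i [i'E s'E]]]]].
    by rewrite inE /= => sA [-> ->]; rewrite insert_in_avoiders special_insert.
  exists (i, s); last by rewrite i'E s'E.
  by rewrite inE /= -(insert_in_avoiders s i) -s'E.
rewrite (exchange_big_dep predT) //= pair_big_dep /=.
by apply: eq_bigl => -[i s]; rewrite !inE.
Qed.

Lemma sum_card_specials n :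
  \sum_(s in avoiders n.+2 tau) #|specials c s| = n * #|avoiders n tau|.
Proof.
have := sum_specials (fun _ : 'S_n.+2 => 1).
under eq_bigr do rewrite muln1; move=> ->.
by rewrite !sum_nat_const card_ord muln1.
Qed.

Lemma sum_card_specials_sq n :
  \sum_(s in avoiders n.+2 tau) #|specials c s| * #|specials c s| <=
  n * (\sum_(s in avoiders n tau) #|specials c s| + 5 * #|avoiders n tau|).
Proof.
rewrite sum_specials.
apply: (@leq_trans (\sum_(i < n) (\sum_(s in avoiders n tau)
    (#|specials c s| + 5)))).
  by apply: leq_sum => i _; apply: leq_sum => s _; exact: card_specials_insert.
rewrite sum_nat_const card_ord big_split /= sum_nat_const.
by rewrite [5 * _]mulnC.
Qed.

(** Cauchy-Schwarz at size [n + 4] with both moments inserted; a common factor [n + 2] cancels. *)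
Lemma avoiders_ratio n :
  n.+2 * #|avoiders n.+2 tau| ^ 2 <=
  #|avoiders n.+4 tau| * (n * #|avoiders n tau| + 5 * #|avoiders n.+2 tau|).
Proof.
have := sum_Cauchy_Schwarz (avoiders n.+4 tau) (fun s => #|specials c s|).
rewrite sum_card_specials => /leq_trans h.
have := h _ (leq_mul (leqnn _) (sum_card_specials_sq n.+2)).
rewrite sum_card_specials expnMn -mulnn -mulnA [X in _ <= X]mulnCA.
by rewrite leq_pmul2l.
Qed.

End Counting.

(** * Alternating subsequences through peaks *)

(** Here [up] is the direction of the next step; [false] at the start matches the descent-first
    convention of [LAS]. *)
Fixpoint zigzag (v : nat -> nat) (up : bool) (x : nat) (l : seq nat) : bool :=
  if l is y :: l' then
    (if up then v x < v y else v y < v x) && zigzag v (~~ up) y l'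
  else true.

Lemma zigzag_nth v up x l i : zigzag v up x l -> i < size l ->
  if up (+) odd i then v (nth 0 (x :: l) i) < v (nth 0 (x :: l) i.+1)
  else v (nth 0 (x :: l) i.+1) < v (nth 0 (x :: l) i).
Proof.
elim: l up x i => [//|y l IH] up x [|i] /= /andP[h z].
  by rewrite addbF; case: up h z.
by rewrite ltnS => il; have := IH _ _ _ z il; rewrite addNb addbN.
Qed.

Definition peak (v : nat -> nat) n p :=
  [&& 0 < p, p.+1 < n, v p.-1 < v p & v p.+1 < v p].

(* Between consecutive peaks p < p' take the lower of p + 1 and p' - 1. *)
Lemma zigzag_peaks v n p l : path ltn p l -> all (peak v n) (p :: l) ->
  exists L, [/\ size L = (size l).*2.+1, path ltn p L,
    all (fun q => q < n) (p :: L) & zigzag v false p L].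
Proof.
elim: l p => [|p' l IH] p.
  move=> _ /=; rewrite andbT => /and4P[_ pn _ down].
  by exists [:: p.+1]; rewrite /= ltnSn down pn (ltnW pn).
move=> /= /andP[pp' pl] /andP[/and4P[_ pn _ down] peaks].
have [L [sL pL aL zL]] := IH p' pl peaks.
move: peaks => /andP[/and4P[_ p'n up _] _].
(* Adjacent positions cannot both be peaks, so a candidate valley exists between them. *)
have gap : p.+1 < p'.
  rewrite ltn_neqAle pp' andbT; apply/eqP => e.
  by move: up; rewrite -e /=; lia.
pose q := if v p.+1 < v p'.-1 then p.+1 else p'.-1.
have qq : [/\ p < q, q < p', v q < v p & v q < v p'].
  by rewrite /q; case: (ltnP (v p.+1) (v p'.-1)) => h; split; lia.
case: qq => pq qp' vqp vqp'.
exists (q :: p' :: L); rewrite /= in aL *; rewrite sL doubleS pq qp' vqp vqp'.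
split=> //; move: aL => /andP[-> ->]; rewrite andbT; lia.
Qed.

Definition value_at n (s : 'S_n) (q : nat) : nat :=
  oapp (fun o : 'I_n => s o : nat) 0 (insub q).

Lemma value_atE n (s : 'S_n) (o : 'I_n) : value_at s o = s o.
Proof. by rewrite /value_at valK. Qed.

Lemma zigzag_LAS n (s : 'S_n) p L : path ltn p L ->
  all (fun q => q < n) (p :: L) -> zigzag (value_at s) false p L ->
  (size L).+1 <= LAS s.
Proof.
move=> sL aL zL; have pn : p < n by case/andP: aL.
set m := (size L).+1; pose l := p :: L.
pose t : {ffun 'I_m -> 'I_n} :=
  [ffun i : 'I_m => insubd (Ordinal pn) (nth 0 l i)].
have tE (i : 'I_m) : t i = nth 0 l i :> nat.
  by rewrite ffunE val_insubd (allP aL) // mem_nth.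
have inc (i j : 'I_m) : i < j -> t i < t j.
  rewrite !tE => ij; apply: (@sorted_ltn_nth _ ltn ltn_trans) => //;
    by rewrite inE ltn_ord.
have tinj : injective t.
  move=> i j e; apply: val_inj; move: (inc i j) (inc j i); rewrite e ltnn.
  by case: (ltngtP i j) => // _ => [/(_ isT) | _ /(_ isT)].
have mn : m < n.+1.
  by rewrite ltnS; have := leq_card t tinj; rewrite !card_ord.
rewrite /LAS.
apply: (@leq_bigmax_cond _ _ (fun m : 'I_n.+1 => m : nat) (Ordinal mn)).
apply/existsP; exists t; apply/andP; split.
  by apply/forallP => i; apply/forallP => j; apply/implyP; exact: inc.
apply/forallP => i; apply/forallP => j; apply/implyP => /eqP ij.
have il : i < size L by have := ltn_ord j; rewrite ij.
have := zigzag_nth zL il; rewrite addFb -/l -ij -!tE !value_atE.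
by case: (odd i).
Qed.

(** The left neighbour is at most [s p] because the anchor dominates [s i]; the right one is
    [s p + 1]. *)
Lemma special_peak c n (s : 'S_n) (i : 'I_n) :
  special c s i -> peak (value_at s) n i.+1.
Proof.
move=> /specialP[p [x [y [anc xi yi sx sy]]]].
have sip := is_anchor_ge anc.
have yn := ltn_ord y; rewrite yi in yn.
by rewrite /peak /= yn /= -yi -xi !value_atE sx sy; lia.
Qed.

(** Each peak contributes itself and one lower entry after it: a valley before the next peak, or the
    right neighbour of the last peak. *)
Lemma card_specials_LAS c n (s : 'S_n) : (#|specials c s|).*2 <= LAS s.
Proof.
rewrite cardE; set e := enum _.
pose l := [seq i.+1 | i : 'I_n <- e].
have szl : size e = size l by rewrite size_map.
have sl : sorted ltn l.
  rewrite /l (map_comp succn (@nat_of_ord n)) sorted_map.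
  rewrite (@eq_sorted _ _ ltn) //.
  have : subseq e (enum 'I_n) by rewrite /e {1}enumT; exact: filter_subseq.
  move=> /(map_subseq (@nat_of_ord n)); rewrite val_enum_ord => h.
  exact: (subseq_sorted ltn_trans h (iota_ltn_sorted 0 n)).
have pl : all (peak (value_at s) n) l.
  apply/allP => q /mapP[i]; rewrite mem_enum inE => si ->.
  exact: special_peak si.
rewrite szl; case: l sl pl {szl} => [//|p l] sl pl.
have [L [sL pL aL zL]] := zigzag_peaks sl pl.
by rewrite /= doubleS -sL; exact: zigzag_LAS pL aL zL.
Qed.

Local Open Scope ring_scope.

(** * Almost monotone ratios *)

Section RatioLimit.
Variables (R : realType) (a : nat -> R) (C L : R).
Hypothesis a_gt0 : forall n, 0 < a n.
Hypothesis C_ge0 : 0 <= C.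
Hypothesis L_gt0 : 0 < L.
Hypothesis a_root : ((fun n : nat => a n `^ n%:R^-1) @ \oo --> L)%classic.
Hypothesis a_ratio : forall n,
  a n.+2 / a n.+4 <= a n / a n.+2 + C / n.+2%:R.

Lemma ratio_window n l : (0 < n)%N ->
  a (n + l.*2)%N / a (n + l.*2).+2 <= a n / a n.+2 + C * l%:R / n%:R.
Proof.
move=> n0; elim: l => [|l IH]; first by rewrite addn0 mulr0 mul0r addr0.
rewrite doubleS !addnS; apply: (le_trans (a_ratio _)).
have -> : C * l.+1%:R / n%:R = C * l%:R / n%:R + C / n%:R.
  by rewrite -natr1 mulrDr mulr1 mulrDl.
rewrite addrA; apply: lerD IH _; apply: ler_wpM2l => //.
by rewrite lef_pV2 ?posrE ?ltr0n // ler_nat; lia.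
Qed.

Lemma ln_root_bound d : 0 < d -> exists N, forall n, (N <= n)%N ->
  n%:R * (ln L - d) <= ln (a n) <= n%:R * (ln L + d).
Proof.
move=> d0.
have : (ln (a n `^ n%:R^-1) @[n --> \oo] --> ln L)%classic.
  by apply: continuous_cvg a_root; exact: continuous_ln.
move=> /cvgrPdist_lt /(_ d d0) [N _ hN]; exists N.+1 => n Nn.
have /= := hN n (ltnW Nn); rewrite ln_powR => h.
have n0 : 0 < n%:R :> R by rewrite ltr0n; lia.
have -> : ln (a n) = n%:R * (n%:R^-1 * ln (a n)).
  by rewrite mulrA divff ?mul1r ?gt_eqF.
move: (n%:R^-1 * _) h => u; rewrite ltr_norml => /andP[h1 h2].
by rewrite !ler_pM2l //; apply/andP; split; lra.
Qed.

(* If the ratio at n were below L^-2 - e, it would stay below L^-2 - e / 2 over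
   a window of length proportional to n, and a would grow too fast there. *)
Lemma ratio_eventually_ge e : 0 < e ->
  exists N, forall n, (N <= n)%N -> L ^- 2 - e <= a n / a n.+2.
Proof.
move=> e0; have rho0 : 0 < L ^- 2 by rewrite invr_gt0 exprn_gt0.
have lnrho : ln (L ^- 2) = - (2 * ln L).
  by rewrite lnV ?posrE ?exprn_gt0 // lnXn // mulr_natl.
(* If [L ^- 2 <= e] the bound is nonpositive; otherwise [rho'] below is positive and has a
   logarithm. *)
have [rho_le|rho_gt] := leP (L ^- 2) e.
  exists 0%N => n _; apply: (@le_trans _ _ 0); first by rewrite subr_le0.
  by rewrite divr_ge0 // ltW.
set rho := L ^- 2 in rho0 lnrho rho_gt *.
pose rho' := rho - e / 2.
have rho'0 : 0 < rho' by rewrite /rho'; lra.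
pose eta := ln rho - ln rho'.
have eta0 : 0 < eta by rewrite subr_gt0 ltr_ln ?posrE // /rho'; lra.
(* With this [K], the ratio drifts by at most [e / 2] over [n / K] double steps. *)
pose K := (Num.bound (C * 2 / e)).+1.
have K0 : 0 < K%:R :> R by rewrite ltr0n.
have CK : C <= e / 2 * K%:R.
  have : C * 2 / e < K%:R.
    have h : 0 <= C * 2 / e by rewrite divr_ge0 ?mulr_ge0 // ltW.
    by apply: (lt_trans (archi_boundP h)); rewrite ltr_nat.
  by rewrite ltr_pdivrMr //; lra.
(* The factor 16 makes the final estimates clash: the root bounds give [m * eta <= 4 * n * d], while
   [n <= 2 * m * K] gives [m * eta >= 8 * n * d]. *)
pose d := eta / (16 * K%:R).
have d0 : 0 < d by rewrite divr_gt0 // mulr_gt0.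
have [N hN] := ln_root_bound d0.
(* The bound [2 * K <= n] makes the rounding in [m = n / K] harmless: [n <= 2 * m * K]. *)
exists (maxn N (2 * K))%N => n; rewrite geq_max => /andP[Nn Kn].
rewrite leNgt; apply/negP => small.
have n_gt0 : (0 < n)%N by apply: leq_trans Kn; rewrite muln_gt0.
pose m := (n %/ K)%N.
have nR0 : 0 < n%:R :> R by rewrite ltr0n.
have mK : (m * K <= n)%N by exact: leq_trunc_div.
have mK' : (n < m.+1 * K)%N by rewrite -ltn_divLR.
have grow l : (l <= m)%N -> a n <= a (n + l.*2)%N * rho' ^+ l.
  elim: l => [|l IH] lm; first by rewrite addn0 expr0 mulr1.
  apply: (le_trans (IH (ltnW lm))).
  rewrite exprS mulrA ler_pM2r ?exprn_gt0 //.
  rewrite doubleS !addnS mulrC -ler_pdivrMr //.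
  apply: (le_trans (ratio_window l n_gt0)).
  suff : C * l%:R / n%:R <= e / 2 by rewrite /rho'; lra.
  rewrite ler_pdivrMr //; apply: (@le_trans _ _ (e / 2 * K%:R * l%:R)).
    by rewrite ler_wpM2r.
  rewrite -mulrA; apply: ler_wpM2l; first by rewrite divr_ge0 // ltW.
  rewrite -natrM ler_nat; apply: leq_trans mK; rewrite mulnC leq_mul2r.
  by rewrite (ltnW lm) orbT.
have := grow m (leqnn m).
rewrite -ler_ln ?posrE ?mulr_gt0 ?exprn_gt0 // lnM ?posrE ?exprn_gt0 //.
rewrite lnXn // -mulr_natl => lnle.
have /andP[lo _] := hN n Nn.
have /andP[_ hi] := hN (n + m.*2)%N (leq_trans Nn (leq_addr _ _)).
have mn : m%:R <= n%:R :> R by rewrite ler_nat leq_div.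
have m_ge : n%:R <= 2 * (m%:R * K%:R) :> R.
  rewrite -!natrM ler_nat; move: mK' Kn; rewrite mulSn; clear.
  by move: (m * K)%N (K) => x y; clear; lia.
move: lo hi lnle; rewrite natrD -muln2 natrM => lo hi lnle.
have key : m%:R * eta <= 4 * (n%:R * d).
  rewrite /eta lnrho; have : m%:R * d <= n%:R * d by rewrite ler_pM2r.
  lra.
have dE : eta = d * (16 * K%:R).
  by rewrite /d mulfVK // mulf_neq0 // gt_eqF.
have : 8 * (n%:R * d) <= m%:R * eta.
  have -> : m%:R * eta = 8 * (2 * (m%:R * K%:R) * d) by rewrite dE; ring.
  by rewrite ler_pM2l // ler_pM2r.
have : 0 < n%:R * d by rewrite mulr_gt0.
lra.
Qed.

End RatioLimit.

(** * From the counting to the lower limit *)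

Lemma limn_einf_ge (R : realType) (u : nat -> \bar R) (x : \bar R) N :
  (forall n, (N <= n)%N -> (x <= u n)%E) -> (x <= limn_einf u)%E.
Proof.
move=> h; rewrite limn_einf_lim (cvg_lim _ (@cvg_einfs_sup _ u)) //.
apply: (@le_trans _ _ (einfs u N)); last by apply: ereal_sup_ubound; exists N.
by apply: le_ereal_inf_tmp => _ [n /= Nn <-]; exact: h.
Qed.

Lemma avoiders_asymptotics (R : realType) c k (tau : 'S_k) : (2 < k)%N ->
  (forall n (s : 'S_n) (i p : 'I_n),
    is_anchor c s i p -> contains (insert_peak s i p) tau -> contains s tau) ->
  ((2 / growth_rate R tau ^+ 2)%:E <=
   limn_einf (fun n : nat =>
     (expect_avoid tau (fun s : 'S_n => (LAS s)%:R : R) / n%:R)%:E))%E.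
Proof.
move=> k2 ins.
pose a n : R := #|avoiders n tau|%:R.
have a_gt0 n : 0 < a n by rewrite ltr0n (avoiders_gt0 ins).
have E_ge0 n : 0 <= expect_avoid tau (fun s : 'S_n => (LAS s)%:R : R) / n%:R.
  by rewrite !divr_ge0 // sumr_ge0.
(* A divergent sequence has limit 0 by convention, and 2 / 0 ^+ 2 = 0. *)
have trivial : growth_rate R tau = 0 -> ((2 / growth_rate R tau ^+ 2)%:E <=
   limn_einf (fun n : nat =>
     (expect_avoid tau (fun s : 'S_n => (LAS s)%:R : R) / n%:R)%:E))%E.
  move=> ->; rewrite expr0n /= invr0 mulr0.
  by apply: (@limn_einf_ge _ _ _ 0) => n _; rewrite lee_fin.
have [a_cvg|/dvgP] := pselect (cvgn (fun n : nat => a n `^ n%:R^-1));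
  last exact: trivial.
have [/trivial//|L_neq0] := eqVneq (growth_rate R tau) 0.
have L_gt0 : 0 < growth_rate R tau.
  rewrite lt_neqAle eq_sym L_neq0 /=; apply: limr_ge => //.
  by apply: nearW => n; exact: powR_ge0.
set L := growth_rate R tau in L_gt0 *.
have a_root : ((fun n : nat => a n `^ n%:R^-1) @ \oo --> L)%classic.
  exact: a_cvg.
(* This is [avoiders_ratio] divided by [(n + 2) * a (n + 2) * a (n + 4)], with the factor [n] of
   [a n] relaxed to [n + 2]. *)
have a_ratio n : a n.+2 / a n.+4 <= a n / a n.+2 + 5 / n.+2%:R.
  have := avoiders_ratio ins n.
  rewrite -(ler_nat R) !(natrM, natrD, natrX) -/(a _) -/(a _) -/(a _) => h.
  have n2 : 0 < n.+2%:R :> R by rewrite ltr0n.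
  have -> : a n / a n.+2 + 5 / n.+2%:R =
     (n.+2%:R * a n + 5 * a n.+2) / (n.+2%:R * a n.+2).
    move: (lt0r_neq0 n2) (lt0r_neq0 (a_gt0 n.+2)).
    by move: (n.+2%:R : R) (a n.+2) => x y x0 y0; field; rewrite x0 y0.
  rewrite ler_pdivrMr // mulrAC ler_pdivlMr ?mulr_gt0 //.
  have -> : a n.+2 * (n.+2%:R * a n.+2) = n.+2%:R * a n.+2 ^+ 2 by ring.
  apply: (le_trans h); rewrite mulrC ler_pM2r // lerD2r ler_pM2r // ler_nat.
  by lia.
have expect_ge n : 2 * n%:R * (a n / a n.+2) <=
    expect_avoid tau (fun s : 'S_n.+2 => (LAS s)%:R : R).
  rewrite /expect_avoid -/(a n.+2) mulrA ler_pM2r ?invr_gt0 //.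
  rewrite -natr_sum /a -!natrM ler_nat -mulnA -(sum_card_specials ins).
  rewrite big_distrr /=; apply: leq_sum => s _; rewrite mul2n.
  exact: card_specials_LAS.
apply/lee_subgt0Pr => e e0.
have rho0 : 0 < L ^- 2 by rewrite invr_gt0 exprn_gt0.
have e4 : 0 < e / 4 by lra.
have [N hN] := ratio_eventually_ge a_gt0 (ler0n R 5) L_gt0 a_root a_ratio e4.
(* Beyond [M], the loss from having [n] insertion places at size [n + 2] is absorbed by [e], of
   which the ratio bound with [e / 4] uses only half. *)
pose M := Num.bound (8 * L ^- 2 / e).
apply: (@limn_einf_ge _ _ _ (maxn N M).+2) => -[//|[//|n]].
rewrite !ltnS geq_max => /andP[Nn Mn].
rewrite -EFinB lee_fin.
have n2 : 0 < n.+2%:R :> R by rewrite ltr0n.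
rewrite ler_pdivlMr //; apply: le_trans (expect_ge n).
have hr := hN n Nn.
have hM : 8 * L ^- 2 <= n.+2%:R * e.
  have h : 0 <= 8 * L ^- 2 / e by rewrite divr_ge0 ?mulr_ge0 // ltW.
  rewrite -ler_pdivrMr //; apply: (le_trans (ltW (archi_boundP h))).
  by rewrite ler_nat; exact: leq_trans Mn (leq_trans (leqnSn _) (leqnSn _)).
have h2 : n%:R * (L ^- 2 - e / 4) <= n%:R * (a n / a n.+2) by rewrite ler_wpM2l.
move: hM h2; rewrite -(natr1 n.+1) -(natr1 n).
move: (L ^- 2) (a n / a n.+2) (ler0n R n) => rho r n0 hM h2.
have en : 0 <= n%:R * e by rewrite mulr_ge0 // ltW.
lra.
Qed.

Theorem theorem2p11 (R : realType) (k : nat) (tau : 'S_k) (hk : (4 <= k)%N)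
    (htau : starts_k_not_k1 tau \/ no_close_neighbours tau) :
  ((2 / growth_rate R tau ^+ 2)%:E <=
   limn_einf (fun n : nat =>
     (expect_avoid tau (fun s : 'S_n => (LAS s)%:R : R) / n%:R)%:E))%E.
Proof.
case: htau => [htau | htau].
  apply: (@avoiders_asymptotics R true); first exact: ltnW.
  move=> n s i p /is_anchor_max[pi pm]; apply: starts_k_insert => //.
  exact: leq_trans hk.
apply: (@avoiders_asymptotics R false); first exact: ltnW.
by move=> n s i p /eqP ->; exact: no_close_insert.
Qed.
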